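(* Assume: (i) $\mathbf h(\mathbf r_j^T\mathbf x)\in\mathrm{Ran}(\boldsymbol\Xi_j)$ for $j=1,\dots,\bar N$; (ii) $\mathbf P\mathbf R^T=\mathbf R^T\mathbf P=\mathbf I_N$ with $\bar N=N$; (iii) the parareal algorithm is initialized by global forecasting, i.e. $\mathbf x_0^{n+1}=\mathcal G_{\mathrm{GF}}(\mathbf x_0^0;T^{n+1})$ for $n=0,\dots,M-1$. Then the parareal method (with local-forecast coarse propagator $\mathcal G=\mathcal G_{\mathrm{LF}}$) converges after parareal initialization, i.e. $K=0$. Further, if the wall time incurred by computing time advancement over one fine time step with the fine propagator dominates all other costs and parallel overhead (the number of processors being equal to $M$), then the method realizes a speedup of $$S_{\mathrm{GF\text{-}LF}}(0)=\frac{m}{\alpha+\bar m}.$$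
   Context: Let $N,M,\bar m$ be positive integers, $m=\bar m M$, $T_{\mathrm{final}}>0$, $h=T_{\mathrm{final}}/m$, $H=\bar m h$; fine time instances $t^i=ih$ ($0\le i\le m$), coarse time instances $T^n=nH=t^{\bar m n}$ ($0\le n\le M$). The fine propagator $\mathcal F(\boldsymbol\xi;t^i,t^j)\in\mathbb R^N$ propagates a state $\boldsymbol\xi\in\mathbb R^N$ from $t^i$ to $t^j$ ($i\le j$), with $\mathcal F(\cdot;t^i,t^k)=\mathcal F(\cdot;t^j,t^k)\circ\mathcal F(\cdot;t^i,t^j)$ for $i\le j\le k$; it typically corresponds to a single-step time integrator. For the initial state $\mathbf x^0\in\mathbb R^N$, the numerical solution is $\mathbf x(t^i):=\mathcal F(\mathbf x^0;0,t^i)$. Let $1\le\bar N\le N$, $\mathbf R=[\mathbf r_1\ \cdots\ \mathbf r_{\bar N}]\in\mathbb R^{N\times\bar N}$ (restriction operator $\mathbf R^T$), $\mathbf P\in\mathbb R^{N\times\bar N}$ (prolongation operator). $\mathbf e_i$ denotes canonical unit vectors, $^+$ the Moore--Penrose pseudoinverse, $\mathrm{Ran}$ the range. For $y:\{t^0,\dots,t^m\}\to\mathbb R$ let $\mathbf h(y)=[y(t^1)-y(t^0)\ \cdots\ y(t^m)-y(t^0)]^T\in\mathbb R^m$; $\mathbf r_j^T\mathbf x$ denotes the function $t^i\mapsto\mathbf r_j^T\mathbf x(t^i)$. For $j=1,\dots,\bar N$, the (global) time-evolution basis $\boldsymbol\Xi_j\in\mathbb R^{m\times a}$ has orthonormal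 columns. The memory is an integer $\alpha$ with $a\le\alpha\le\bar m$, and $\mathbf Z_0$ extracts the first $\alpha$ entries of a vector. The global forecast is $$\mathcal G_{\mathrm{GF}}(\boldsymbol\xi;T^n)=\mathbf P\mathbf R^T\boldsymbol\xi+\mathbf P\sum_{i=1}^{\alpha}\bar{\boldsymbol\Gamma}_i^n[\mathbf R^T\mathcal F(\boldsymbol\xi;t^0,t^i)-\mathbf R^T\boldsymbol\xi],\quad \bar{\boldsymbol\Gamma}_i^n=\mathrm{diag}(\bar\gamma_{i1}^n,\dots,\bar\gamma_{i\bar N}^n),\quad\bar\gamma_{ij}^n=\mathbf e_{\bar m n}^T\boldsymbol\Xi_j[\mathbf Z_0\boldsymbol\Xi_j]^+\mathbf e_i.$$ The local-forecast coarse propagator is $\mathcal G_{\mathrm{LF}}(\boldsymbol\xi;T^n,T^{n+1})=\mathbf P\mathbf R^T\boldsymbol\xi+\mathbf P\sum_{i=1}^{\alpha}\boldsymbol\Gamma_i^n[\mathbf R^T\mathcal F(\boldsymbol\xi;T^n,t^{\bar m n+i})-\mathbf R^T\boldsymbol\xi]$, where $\boldsymbol\Gamma_i^n$ is diagonal with $j$-th entry $\mathbf e_{\bar m}^T\boldsymbol\Xi_j^n[\mathbf Z_0\boldsymbol\Xi_j^n]^+\mathbf e_i$ for given matrices $\boldsymbol\Xi_j^n$ with $\bar m$ rows and orthonormal columns (local time-evolution bases). Parareal algorithm (inputs $\mathcal F$, $\mathcal G$, $\mathbf x_0^0=\mathbf x^0$, tolerance $\epsilon$): (1) compute an initialization $\mathbf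 x_0^1,\dots,\mathbf x_0^M$. (2) In parallel, $\mathbf f_0^{n+1}=\mathcal F(\mathbf x_0^n;T^n,T^{n+1})$, $n=0,\dots,M-1$; set $k=0$. (3) While $\|\mathbf f_k^n-\mathbf x_k^n\|/\|\mathbf f_k^n\|>\epsilon$ for some $n\in\{k+1,\dots,M-1\}$: (a) if $k=0$, compute in parallel $\mathbf g_0^{n+1}=\mathcal G(\mathbf x_0^n;T^n,T^{n+1})$, $n=1,\dots,M-1$ (and $\mathbf g_0^1=\mathbf g_1^1$); (b) $\mathbf x_{k+1}^k=\mathbf x_k^k$; (c) serially for $n=k,\dots,M-1$: $\mathbf g_{k+1}^{n+1}=\mathcal G(\mathbf x_{k+1}^n;T^n,T^{n+1})$, $\mathbf x_{k+1}^{n+1}=\mathbf g_{k+1}^{n+1}+\mathbf f_k^{n+1}-\mathbf g_k^{n+1}$; (d) in parallel $\mathbf f_{k+1}^{n+1}=\mathcal F(\mathbf x_{k+1}^n;T^n,T^{n+1})$, $n=k,\dots,M-1$; then $k\leftarrow k+1$. (4) Replace $\mathbf x_k^{n+1}$ by $\mathbf f_k^{n+1}$, $n=k,\dots,M-1$. $K$ denotes the final value of $k$ (the number of parareal iterations). Speedup is the ratio of the wall time of the serial solution with the fine propagator (over all $m$ fine time steps) to the wall time of the parareal method.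
   Formalization: The formal theorem additionally assumes that each sampled basis Z_0 Ξ_j has full column rank a; without this the claim fails (e.g. Ξ = (0,1,0)^T with α = 1, where the forecast misses the solution). *)

(* Defs.v *)
From HB Require Import structures.
From mathcomp Require Import all_boot all_order all_algebra.
From mathcomp Require Import all_classical all_reals all_analysis.
Set Implicit Arguments.
Unset Strict Implicit.
Unset Printing Implicit Defensive.
Import Order.TTheory GRing.Theory Num.Theory.
Import numFieldNormedType.Exports.
Local Open Scope classical_set_scope.
Local Open Scope ring_scope.

(** * Moore--Penrose pseudoinverse *)

Definition is_mp_pinv (R : realType) (p q : nat) (A : 'M[R]_(p, q))
    (X : 'M[R]_(q, p)) : Prop :=
  [/\ A *m X *m A = A, X *m A *m X = X,
      (A *m X)^T = A *m X & (X *m A)^T = X *m A].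

(* MathComp's [pinvmx] is only a one-sided partial inverse. *)
Definition mp_pinv (R : realType) (p q : nat) (A : 'M[R]_(p, q)) : 'M[R]_(q, p) :=
  xget 0 [set X | is_mp_pinv A X].

Lemma row_free_gram (R : realType) (p q : nat) (A : 'M[R]_(p, q)) :
  row_free A -> A *m A^T \in unitmx.
Proof.
move=> fA; rewrite -row_free_unit -kermx_eq0; apply/eqP/row_matrixP => i.
rewrite row0; set v := row i _.
have hv : v *m (A *m A^T) = 0 by apply/sub_kermxP; rewrite row_sub.
have hw : (v *m A) *m (v *m A)^T = 0.
  by rewrite trmx_mul mulmxA -(mulmxA v) hv mul0mx.
suff hz : v *m A = 0.
  by move: (row_freeP fA) => [B AB]; rewrite -[v]mulmx1 -AB mulmxA hz mul0mx.
apply/rowP => j; have := congr1 (fun W : 'M[R]_1 => W 0 0) hw; rewrite !mxE.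
under eq_bigr => k _ do rewrite [X in _ * X]mxE -expr2.
move/eqP; rewrite psumr_eq0; last by move=> k _; exact: sqr_ge0.
move/allP/(_ j (mem_index_enum j)); rewrite implyTb sqrf_eq0 mxE.
by move/eqP.
Qed.

Lemma mp_pinv_exists (R : realType) (p q : nat) (A : 'M[R]_(p, q)) :
  exists X, is_mp_pinv A X.
Proof.
have [r [C [B [fC fB <-]]]] : exists r (C : 'M[R]_(p, r)) (B : 'M[R]_(r, q)),
    [/\ row_full C, row_free B & C *m B = A].
  exists (\rank A), (col_base A), (row_base A).
  by rewrite col_base_full row_base_free mulmx_base.
have uB : B *m B^T \in unitmx by exact: row_free_gram.
have uC : C^T *m C \in unitmx.
  rewrite -{2}[C]trmxK; apply: row_free_gram.
  by rewrite /row_free mxrank_tr.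
pose X := B^T *m invmx (B *m B^T) *m invmx (C^T *m C) *m C^T.
have AX : C *m B *m X = C *m invmx (C^T *m C) *m C^T.
  by rewrite /X !mulmxA -(mulmxA C B) -(mulmxA C) mulmxV // mulmx1.
have XA : X *m (C *m B) = B^T *m invmx (B *m B^T) *m B.
  by rewrite /X !mulmxA -(mulmxA _ C^T C) -(mulmxA _ (invmx (C^T *m C)))
    mulVmx // mulmx1.
exists X; split.
- by rewrite AX !mulmxA -(mulmxA _ C^T C) -(mulmxA C) mulVmx // mulmx1.
- rewrite XA /X !mulmxA -(mulmxA _ B B^T).
  by rewrite -(mulmxA _ (invmx (B *m B^T)) (B *m B^T)) mulVmx // mulmx1.
- by rewrite AX !trmx_mul trmxK trmx_inv trmx_mul trmxK mulmxA.
- by rewrite XA !trmx_mul trmxK trmx_inv trmx_mul trmxK mulmxA.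
Qed.

Lemma mp_pinvP (R : realType) (p q : nat) (A : 'M[R]_(p, q)) : is_mp_pinv A (mp_pinv A).
Proof. by have [X AX] := mp_pinv_exists A; exact: (xgetI 0 AX). Qed.

Lemma mp_pinv_unique (R : realType) (p q : nat) (A : 'M[R]_(p, q)) X Y :
  is_mp_pinv A X -> is_mp_pinv A Y -> X = Y.
Proof.
move=> [x1 x2 x3 x4] [y1 y2 y3 y4].
have XAYA : X *m A = Y *m A.
  rewrite -x4 -{1}y1 mulmxA (mulmxA X) -mulmxA trmx_mul x4 y4.
  by rewrite !mulmxA -(mulmxA _ A X) -(mulmxA Y (A *m X)) x1.
have AXAY : A *m X = A *m Y.
  rewrite -x3 -{1}y1 -(mulmxA (A *m Y)) trmx_mul x3 y3.
  by rewrite !mulmxA x1.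
by rewrite -x2 -mulmxA AXAY mulmxA XAYA y2.
Qed.

(** * Time grid and fine propagator *)

Definition fine_time (R : realType) (Tf : R) (m i : nat) : R :=
  i%:R * (Tf / m%:R).

(* [F xi s t] is the state reached at time [t] from the state [xi] at time [s];
   only its values at fine time instances [s <= t] matter. *)
Definition is_fine_propagator (R : realType) (N : nat) (Tf : R) (m : nat)
    (F : 'cV[R]_N -> R -> R -> 'cV[R]_N) : Prop :=
  let t := fine_time Tf m in
  (forall xi i, (i <= m)%N -> F xi (t i) (t i) = xi) /\
  (forall xi i j k, (i <= j)%N -> (j <= k)%N -> (k <= m)%N ->
     F xi (t i) (t k) = F (F xi (t i) (t j)) (t j) (t k)).

Definition fine_solution (R : realType) (N : nat)
    (F : 'cV[R]_N -> R -> R -> 'cV[R]_N) (x0 : 'cV[R]_N) (s : R) : 'cV[R]_N :=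
  F x0 0 s.

(* The time evolution of [y]: its increments from the initial time. *)
Definition evolution (R : realType) (Tf : R) (m : nat) (y : R -> R) : 'cV[R]_m :=
  \col_(i < m) (y (fine_time Tf m i.+1) - y (fine_time Tf m 0)).

(** * Forecasting *)

(* Canonical unit vectors are numbered from 1. *)
Definition unit_vec (R : realType) (d i : nat) : 'cV[R]_d :=
  \col_(k < d) (k.+1 == i)%:R.

(* Left multiplication by [sampling alpha d] extracts the first [alpha] entries
   of a vector of length [d] (for [alpha <= d]). *)
Definition sampling (R : realType) (alpha d : nat) : 'M[R]_(alpha, d) :=
  \matrix_(i < alpha, k < d) (i == k :> nat)%:R.

Definition forecast_coef (R : realType) (alpha d b : nat) (Xi : 'M[R]_(d, b))
    (r i : nat) : R :=
  ((unit_vec R d r)^T *m Xi *m mp_pinv (sampling R alpha d *m Xi)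
     *m unit_vec R alpha i) 0 0.

(* [y i], 1 <= i <= alpha, are the sampled fine states, [gam i j] the diagonal
   entries of the i-th coefficient matrix; [Rm] is the matrix whose transpose
   is the restriction operator. *)
Definition forecast (R : realType) (N Nbar : nat) (P Rm : 'M[R]_(N, Nbar))
    (alpha : nat) (gam : nat -> 'I_Nbar -> R) (xi : 'cV[R]_N)
    (y : nat -> 'cV[R]_N) : 'cV[R]_N :=
  P *m Rm^T *m xi +
  P *m \sum_(1 <= i < alpha.+1)
         diag_mx (\row_j gam i j) *m (Rm^T *m y i - Rm^T *m xi).

Definition global_forecast (R : realType) (N Nbar : nat)
    (P Rm : 'M[R]_(N, Nbar)) (mbar m a alpha : nat)
    (Xi : 'I_Nbar -> 'M[R]_(m, a)) (n : nat) :
    'cV[R]_N -> (nat -> 'cV[R]_N) -> 'cV[R]_N :=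
  forecast P Rm alpha (fun i j => forecast_coef alpha (Xi j) (mbar * n) i).

Definition local_forecast (R : realType) (N Nbar : nat)
    (P Rm : 'M[R]_(N, Nbar)) (mbar alpha : nat) (aloc : nat -> 'I_Nbar -> nat)
    (Xiloc : forall n j, 'M[R]_(mbar, aloc n j)) (n : nat) :
    'cV[R]_N -> (nat -> 'cV[R]_N) -> 'cV[R]_N :=
  forecast P Rm alpha (fun i j => forecast_coef alpha (Xiloc n j) mbar i).

(** * Timed computations *)

(* A result together with the number of fine time steps on the critical path of
   the computation that produced it. *)
Record timed (A : Type) := Timed { tvalue : A; fine_steps : nat }.

Definition tret (A : Type) (v : A) : timed A := Timed v 0.

Definition tbind (A B : Type) (c : timed A) (k : A -> timed B) : timed B :=
  Timed (tvalue (k (tvalue c))) (fine_steps c + fine_steps (k (tvalue c))).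

Definition tmap (A B : Type) (f : A -> B) (c : timed A) : timed B :=
  Timed (f (tvalue c)) (fine_steps c).

(* Parallel loop for n = lo, ..., hi-1 on [p] processors, task [n] running on
   processor [n mod p]; task [n] overwrites entry [n+1] of [old]. *)
Definition tpar (A : Type) (p lo hi : nat) (task : nat -> timed A)
    (old : nat -> A) : timed (nat -> A) :=
  Timed
    (fun l => if (lo < l <= hi)%N then tvalue (task l.-1) else old l)
    (\max_(q < p) \sum_(lo <= n < hi | (n %% p)%N == q) fine_steps (task n))%N.

(* [d] successive fine time steps from [t^i0], keeping every intermediate state:
   the [i]-th one is F(xi; t^i0, t^(i0+i)). All fine time steps of the programs
   below are taken here. *)
Definition advance (R : realType) (N : nat) (Tf : R) (m : nat)
    (F : 'cV[R]_N -> R -> R -> 'cV[R]_N) (i0 d : nat) (xi : 'cV[R]_N) :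
    timed (nat -> 'cV[R]_N) :=
  let t := fine_time Tf m in
  Timed (fun i => F xi (t i0) (t (i0 + i)%N)) d.

Definition serial_solve (R : realType) (N : nat) (Tf : R) (m : nat)
    (F : 'cV[R]_N -> R -> R -> 'cV[R]_N) (x0 : 'cV[R]_N) :
    timed (nat -> 'cV[R]_N) :=
  advance Tf m F 0 m x0.

(* F(xi; T^n, T^(n+1)), where T^n = t^(mbar n). *)
Definition fine_prop (R : realType) (N : nat) (Tf : R) (mbar m : nat)
    (F : 'cV[R]_N -> R -> R -> 'cV[R]_N) (n : nat) (xi : 'cV[R]_N) :
    timed 'cV[R]_N :=
  tmap (fun y => y mbar) (advance Tf m F (mbar * n) mbar xi).

(* G_LF(xi; T^n, T^(n+1)) *)
Definition coarse_LF (R : realType) (N Nbar : nat) (Tf : R)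
    (F : 'cV[R]_N -> R -> R -> 'cV[R]_N) (P Rm : 'M[R]_(N, Nbar))
    (mbar m alpha : nat) (aloc : nat -> 'I_Nbar -> nat)
    (Xiloc : forall n j, 'M[R]_(mbar, aloc n j)) (n : nat) (xi : 'cV[R]_N) :
    timed 'cV[R]_N :=
  tmap (local_forecast P Rm alpha Xiloc n xi)
       (advance Tf m F (mbar * n) alpha xi).

(* x_0^0 = x0 and x_0^l = G_GF(x0; T^l) for l >= 1: one sampling of the first
   [alpha] fine steps serves every coarse time instance. *)
Definition init_GF (R : realType) (N Nbar : nat) (Tf : R)
    (F : 'cV[R]_N -> R -> R -> 'cV[R]_N) (P Rm : 'M[R]_(N, Nbar))
    (mbar m a alpha : nat) (Xi : 'I_Nbar -> 'M[R]_(m, a)) (x0 : 'cV[R]_N) :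
    timed (nat -> 'cV[R]_N) :=
  tmap (fun y l => if l is 0 then x0
                   else global_forecast P Rm mbar alpha Xi l x0 y)
       (advance Tf m F 0 alpha x0).

(** * Parareal *)

Definition l2norm (R : realType) (N : nat) (v : 'cV[R]_N) : R :=
  Num.sqrt (\sum_i v i 0 ^+ 2).

Definition upd (A : Type) (u : nat -> A) (l : nat) (v : A) : nat -> A :=
  fun l' => if l' == l then v else u l'.

(* At iteration [k] the entries [l] of [px], [pf], [pg] hold x_k^l, f_k^l, g_k^l
   (stale values remain where the algorithm assigns none). *)
Record pstate (V : Type) := PState {
  piter : nat; px : nat -> V; pf : nat -> V; pg : nat -> V }.

(* Division by zero yields 0, so the test passes when f and x both vanish. *)
Definition parareal_test (R : realType) (N M : nat) (eps : R)
    (s : pstate 'cV[R]_N) : bool :=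
  has (fun n => eps < l2norm (pf s n - px s n) / l2norm (pf s n))
      (index_iota (piter s).+1 M).

(* One step of the serial correction loop: [xg] holds the partially updated
   (x_(k+1), g_(k+1)). For k = n = 0 the algorithm sets g_0^1 = g_1^1. *)
Definition correction (R : realType) (N : nat)
    (G : nat -> 'cV[R]_N -> timed 'cV[R]_N) (k : nat)
    (f g : nat -> 'cV[R]_N) (n : nat)
    (xg : (nat -> 'cV[R]_N) * (nat -> 'cV[R]_N)) :
    timed ((nat -> 'cV[R]_N) * (nat -> 'cV[R]_N)) :=
  tbind (G n (xg.1 n)) (fun gnew =>
  let gold := if (k == 0)%N && (n == 0)%N then gnew else g n.+1 in
  tret (upd xg.1 n.+1 (gnew + f n.+1 - gold), upd xg.2 n.+1 gnew)).

Definition parareal_body (R : realType) (N p M : nat)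
    (Fp G : nat -> 'cV[R]_N -> timed 'cV[R]_N) (s : pstate 'cV[R]_N) :
    timed (pstate 'cV[R]_N) :=
  let k := piter s in
  tbind (if k == 0%N then tpar p 1 M (fun n => G n (px s n)) (pg s)
         else tret (pg s)) (fun g =>
  tbind (foldl (fun c n => tbind c (correction G k (pf s) g n))
               (tret (px s, g)) (index_iota k M)) (fun xg =>
  tbind (tpar p k M (fun n => Fp n (xg.1 n)) (pf s)) (fun f =>
  tret (PState k.+1 xg.1 f xg.2)))).

(* The test ranges over n = k+1, ..., M-1, so it fails at the latest for
   k = M-1 and the bound [fuel = M] never cuts the loop short. *)
Fixpoint parareal_loop (R : realType) (N p M : nat) (eps : R)
    (Fp G : nat -> 'cV[R]_N -> timed 'cV[R]_N) (fuel : nat)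
    (s : pstate 'cV[R]_N) : timed (pstate 'cV[R]_N) :=
  if fuel is fuel'.+1 then
    if parareal_test M eps s
    then tbind (parareal_body p M Fp G s)
               (parareal_loop p M eps Fp G fuel')
    else tret s
  else tret s.

Definition parareal_final (V : Type) (M : nat) (s : pstate V) : pstate V :=
  PState (piter s)
    (fun l => if (piter s < l <= M)%N then pf s l else px s l) (pf s) (pg s).

(* [p] is the number of processors, [init] the program computing
   x_0^0, ..., x_0^M. *)
Definition parareal (R : realType) (N p M : nat) (eps : R)
    (Fp G : nat -> 'cV[R]_N -> timed 'cV[R]_N)
    (init : timed (nat -> 'cV[R]_N)) : timed (pstate 'cV[R]_N) :=
  tbind init (fun x =>
  tbind (tpar p 0 M (fun n => Fp n (x n)) (fun=> 0)) (fun f =>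
  tmap (parareal_final M)
       (parareal_loop p M eps Fp G M (PState 0 x f (fun=> 0))))).

Definition parareal_iterations (V : Type) (run : timed (pstate V)) : nat :=
  piter (tvalue run).

(** * Wall time *)

(* [tau] is the wall time of one fine time step, [other] the wall time of
   everything else, including parallel overhead. *)
Definition wall_time (R : realType) (A : Type) (tau other : R) (c : timed A) : R :=
  (fine_steps c)%:R * tau + other.

Definition speedup (R : realType) (A B : Type) (tau oser opar : R)
    (serial : timed A) (run : timed B) : R :=
  wall_time tau oser serial / wall_time tau opar run.

(* Along [Phi], the fine time step dominates the costs [other]. *)
Definition negligible_wrt (R : realType) (I : Type) (Phi : set_system I)
    (tau other : I -> R) : Prop :=
  (forall s, 0 <= other s) /\ (fun s => other s / tau s) @ Phi --> (0 : R).

(* Main.v *)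
(* The increments of each component of the restricted solution lie in the range
   of its basis, so the least-squares fit to their first [alpha] entries, being
   of full column rank, recovers them exactly. Hence the global forecast gives
   the fine solution at all coarse time instances, every residual tested by
   parareal vanishes, and the only fine time steps on the critical path are
   [alpha] for the forecast and [mbar] for the single parallel sweep. *)

Require Import Defs.
From HB Require Import structures.
From mathcomp Require Import all_boot all_order all_algebra.
From mathcomp Require Import all_classical all_reals all_analysis.
Import Order.TTheory GRing.Theory Num.Theory.
Import numFieldNormedType.Exports.
Local Open Scope classical_set_scope.
Local Open Scope ring_scope.

Set Implicit Arguments.
Unset Strict Implicit.

Lemma mulmx_unit_vec (R : realType) (q d : nat) (A : 'M[R]_(q, d)) (i : 'I_d) :
  A *m unit_vec R d i.+1 = col i A.
Proof.
apply/colP => k; rewrite !mxE (bigD1 i) //= mxE eqxx mulr1 big1 ?addr0 // => l li.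
by rewrite mxE eqSS (inj_eq val_inj) (negPf li) mulr0.
Qed.

Lemma tr_unit_vec_mulmx (R : realType) (d q : nat) (A : 'M[R]_(d, q)) (i : 'I_d) :
  (unit_vec R d i.+1)^T *m A = row i A.
Proof. by rewrite -[A in LHS]trmxK -trmx_mul mulmx_unit_vec tr_col trmxK. Qed.

(** Full column rank gives a left inverse of [A]; applied to the first Moore-Penrose identity, it
    cancels the leading [A]. *)
Lemma mp_pinv_mulmx (R : realType) (p q : nat) (A : 'M[R]_(p, q)) :
  \rank A = q -> mp_pinv A *m A = 1%:M.
Proof.
move=> rA; have fA : row_full A by rewrite /row_full rA.
have [AXA _ _ _] := mp_pinvP A.
have /row_fullP[B BA] := fA.
by rewrite -[LHS]mul1mx -{1}BA -!mulmxA [A *m (_ *m _)]mulmxA AXA.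
Qed.

Lemma samplingE (R : realType) (alpha d : nat) (le_ad : (alpha <= d)%N)
    (v : 'cV[R]_d) (i : 'I_alpha) :
  (sampling R alpha d *m v) i 0 = v (widen_ord le_ad i) 0.
Proof.
rewrite mxE (bigD1 (widen_ord le_ad i)) //= mxE eqxx mul1r big1 ?addr0 // => k ki.
rewrite mxE; case: eqP => [ik|_]; last by rewrite mul0r.
by move: ki; rewrite -(inj_eq val_inj) /= ik eqxx.
Qed.

(** The samples are the sampled basis times [c], so the pseudoinverse returns [c] itself, and row
    [r] of [Xi] then evaluates the evolution at time [r]. *)
Lemma forecast_coef_exact (R : realType) (alpha d b : nat) (Xi : 'M[R]_(d, b))
    (y : nat -> R) (c : 'cV[R]_b) (r : nat) :
  (alpha <= d)%N -> \rank (sampling R alpha d *m Xi) = b ->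
  \col_(k < d) y k.+1 = Xi *m c -> (0 < r <= d)%N ->
  \sum_(1 <= i < alpha.+1) forecast_coef alpha Xi r i * y i = y r.
Proof.
(* Rows are numbered from 1 in [unit_vec] but from 0 in ordinals, hence the shift of [r]. *)
move=> le_ad rk yE; case: r => // r /= lt_rd.
pose h : 'cV[R]_d := \col_k y k.+1.
have -> : y r.+1 = h (Ordinal lt_rd) 0 by rewrite mxE.
rewrite big_add1 /= big_mkord.
set W := (unit_vec R d r.+1)^T *m Xi *m mp_pinv (sampling R alpha d *m Xi).
transitivity ((W *m (sampling R alpha d *m h)) 0 0).
  rewrite [RHS]mxE; apply: eq_bigr => i _.
  rewrite /forecast_coef mulmx_unit_vec.
  by rewrite [col _ _ _ _]mxE (samplingE le_ad) [h _ _]mxE.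
rewrite /h yE [sampling _ _ _ *m _]mulmxA /W -mulmxA [mp_pinv _ *m _]mulmxA.
by rewrite mp_pinv_mulmx // mul1mx -mulmxA (tr_unit_vec_mulmx _ (Ordinal lt_rd)) mxE.
Qed.

Lemma mulmx_tr_col (R : realType) (N q : nat) (A : 'M[R]_(N, q)) (v : 'cV[R]_N)
    (j : 'I_q) : (A^T *m v) j 0 = ((col j A)^T *m v) 0 0.
Proof. by rewrite !mxE; apply: eq_bigr => k _; rewrite !mxE. Qed.

Lemma global_forecast_exact (R : realType) (N Nbar mbar m a alpha n : nat)
    (P Rm : 'M[R]_(N, Nbar)) (Xi : 'I_Nbar -> 'M[R]_(m, a))
    (xi : 'cV[R]_N) (y : nat -> 'cV[R]_N) :
  (alpha <= m)%N -> (forall j, \rank (sampling R alpha m *m Xi j) = a) ->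
  P *m Rm^T = 1%:M ->
  (forall j, exists c, Xi j *m c = \col_(k < m) (Rm^T *m (y k.+1 - xi)) j 0) ->
  (0 < mbar * n <= m)%N ->
  global_forecast P Rm mbar alpha Xi n xi y = y (mbar * n)%N.
Proof.
move=> le_am rk PR hXi hn; rewrite /global_forecast /forecast.
set S := \sum_(1 <= i < alpha.+1) _.
(* The coefficient matrices are diagonal, so this splits into one scalar forecast per component [j],
   each with its own basis. *)
have -> : S = Rm^T *m (y (mbar * n)%N - xi).
  apply/colP => j; have [c cE] := hXi j.
  rewrite -(forecast_coef_exact (y := fun i => (Rm^T *m (y i - xi)) j 0)
    le_am (rk j) (esym cE) hn).
  rewrite /S summxE; apply: eq_bigr => i _.
  by rewrite -mulmxBr mul_diag_mx 2!mxE.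
by rewrite mulmxA PR !mul1mx addrC subrK.
Qed.

(** With as many processors as tasks, [n %% p = n]: each processor runs a single task, and the
    maximum is over [p] equal costs. *)
Lemma fine_steps_tpar (A : Type) (p c : nat) (task : nat -> timed A)
    (old : nat -> A) :
  (0 < p)%N -> (forall n, fine_steps (task n) = c) ->
  fine_steps (tpar p 0 p task old) = c.
Proof.
move=> p_gt0 taskE /=.
under eq_bigr => q _.
  rewrite big_mkord (bigD1 q) ?modn_small //= taskE big1 ?addn0; last first.
    by move=> i /andP[]; rewrite modn_small // (inj_eq val_inj) => ->.
  over.
by case: p p_gt0 => // p _; rewrite big_const_ord iterS; elim: p => [|p IH] /=;
  rewrite ?maxn0 // {1}IH maxnn.
Qed.

(** An equality of timed computations, so it yields both the iteration count and the cost. *)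
Lemma parareal_no_iteration (R : realType) (N p M : nat) (eps : R)
    (Fp G : nat -> 'cV[R]_N -> timed 'cV[R]_N)
    (init : timed (nat -> 'cV[R]_N)) :
  0 <= eps ->
  (forall n, (n.+1 < M)%N ->
     tvalue (Fp n (tvalue init n)) = tvalue init n.+1) ->
  parareal p M eps Fp G init =
  tbind init (fun x => tmap (fun f => parareal_final M (PState 0 x f (fun=> 0)))
                         (tpar p 0 M (fun n => Fp n (x n)) (fun=> 0))).
Proof.
move=> eps0 fpE; rewrite /parareal /tbind /=; case: M fpE => [|M] fpE.
  by rewrite /= addn0.
rewrite /parareal_loop /= ifF ?addn0 //.
apply/negP => /hasP[n]; rewrite mem_index_iota /= => /andP[n0 nM].
(* A tested index is positive, so its [pf] entry comes from a task and not from the default 0; the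
   residual is then 0, whatever its denominator. *)
case: n n0 nM => // n _ nM; rewrite (ltnW nM) /= fpE // subrr.
suff -> : l2norm (0 : 'cV[R]_N) = 0 by rewrite mul0r ltNge eps0.
by rewrite /l2norm big1 ?sqrtr0 // => i _; rewrite mxE expr0n.
Qed.

(** Dividing through by [tau] isolates the ratios that [negligible_wrt] sends to 0. *)
Lemma speedupE (R : realType) (A B : Type) (tau oser opar : R)
    (serial : timed A) (run : timed B) : tau != 0 ->
  speedup tau oser opar serial run =
  ((fine_steps serial)%:R + oser / tau) / ((fine_steps run)%:R + opar / tau).
Proof.
move=> tau0; rewrite /speedup /wall_time.
have E k o : k%:R * tau + o = (k%:R + o / tau) * tau by rewrite mulrDl divfK.
by rewrite !E -mulf_div divff // mulr1.
Qed.

Lemma cvg_cstD (R : realType) (I : Type) (Phi : set_system I) (c : R) (f : I -> R) :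
  ProperFilter Phi ->
  f @ Phi --> (0 : R) -> (fun s => c + f s) @ Phi --> (c : R).
Proof.
move=> PF f0; rewrite -[X in _ --> X]addr0.
by apply: (@cvgD _ _ _ Phi _ (fun=> c) f) => //; exact: cvg_cst.
Qed.

Lemma cvg_speedup (R : realType) (A B I : Type) (Phi : set_system I)
    (tau oser opar : I -> R) (serial : timed A) (run : timed B) :
  ProperFilter Phi -> (0 < fine_steps run)%N -> (forall s, 0 < tau s) ->
  negligible_wrt Phi tau oser -> negligible_wrt Phi tau opar ->
  (fun s => speedup (tau s) (oser s) (opar s) serial run) @ Phi -->
    ((fine_steps serial)%:R / (fine_steps run)%:R : R).
Proof.
move=> PF run0 tau0 [_ ser] [_ par].
under eq_fun => s do rewrite speedupE ?gt_eqF //.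
by apply: cvgM; [|apply: cvgV; first by rewrite pnatr_eq0 -lt0n]; exact: cvg_cstD.
Qed.

Theorem theorem4p7 (R : realType) (N M mbar Nbar a alpha : nat)
  (hN : (0 < N)%N) (hM : (0 < M)%N) (hmbar : (0 < mbar)%N)
  (hNbar : (1 <= Nbar <= N)%N)
  (Tf : R) (hTf : 0 < Tf)
  (F : 'cV[R]_N -> R -> R -> 'cV[R]_N)
  (hF : is_fine_propagator Tf (mbar * M) F)
  (x0 : 'cV[R]_N)
  (P Rm : 'M[R]_(N, Nbar))
  (Xi : 'I_Nbar -> 'M[R]_(mbar * M, a))
  (hXi : forall j, (Xi j)^T *m Xi j = 1%:M)
  (halpha : (a <= alpha <= mbar)%N)
  (hrank : forall j, \rank (sampling R alpha (mbar * M) *m Xi j) = a)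
  (aloc : nat -> 'I_Nbar -> nat)
  (Xiloc : forall n j, 'M[R]_(mbar, aloc n j))
  (hXiloc : forall n j, (n < M)%N -> (Xiloc n j)^T *m Xiloc n j = 1%:M)
  (eps : R) (heps : 0 <= eps)
  (init : timed (nat -> 'cV[R]_N))
  (h_i : forall j : 'I_Nbar,
     range (fun c : 'cV[R]_a => Xi j *m c)
       (evolution Tf (mbar * M)
          (fun s => ((col j Rm)^T *m fine_solution F x0 s) 0 0)))
  (h_ii : [/\ Nbar = N, P *m Rm^T = 1%:M & Rm^T *m P = 1%:M])
  (h_iii : init = init_GF Tf F P Rm mbar alpha Xi x0) :
  let run p := parareal p M eps (fine_prop Tf mbar (mbar * M) F)
                 (coarse_LF Tf F P Rm (mbar * M) alpha Xiloc) init in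
  let serial := serial_solve Tf (mbar * M) F x0 in
  (forall p, parareal_iterations (run p) = 0%N) /\
  (forall p, p = M ->
     (forall tau : R, 0 < tau ->
        speedup tau 0 0 serial (run p)
          = (mbar * M)%:R / (alpha + mbar)%:R) /\
     (forall (I : Type) (Phi : set_system I) (tau oser opar : I -> R),
        ProperFilter Phi ->
        (forall s, 0 < tau s) ->
        negligible_wrt Phi tau oser -> negligible_wrt Phi tau opar ->
        (fun s => speedup (tau s) (oser s) (opar s) serial (run p)) @ Phi
          --> ((mbar * M)%:R / (alpha + mbar)%:R : R))).
Proof.
move=> run serial.
have [_ PR _] := h_ii; have /andP[_ le_amb] := halpha.
have le_am : (alpha <= mbar * M)%N by rewrite (leq_trans le_amb) ?leq_pmulr.
(* [fine_solution] starts at the real number 0, the propagator laws at the grid point [fine_time] 0;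
   this identifies them. *)
have t0 : fine_time Tf (mbar * M) 0 = 0 by rewrite /fine_time mul0r.
have [F_id F_comp] := hF.
pose y i := F x0 (fine_time Tf (mbar * M) 0) (fine_time Tf (mbar * M) (0 + i)).
have y0 : y 0%N = x0 by exact: F_id.
have sol0 : fine_solution F x0 (fine_time Tf (mbar * M) 0) = x0.
  by rewrite /fine_solution -[X in F _ X]t0 F_id.
have initE n : (n <= M)%N -> tvalue init n = y (mbar * n)%N.
  (* Entry 0 is [x0] itself; only later entries are forecasts. *)
  rewrite h_iii; case: n => [|n] lt_nM; first by rewrite muln0 y0.
  apply: global_forecast_exact => //; last first.
    by rewrite muln_gt0 hmbar leq_mul2l lt_nM orbT.
  move=> j; have [c _ cE] := h_i j; exists c; rewrite cE.
  apply/colP => k; rewrite [LHS]mxE [RHS]mxE -!mulmx_tr_col sol0 mulmxBr.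
  by rewrite [RHS]mxE [X in _ = _ + X]mxE /fine_solution -[in LHS]t0.
have fpE n : (n.+1 < M)%N ->
    tvalue (fine_prop Tf mbar (mbar * M) F n (tvalue init n)) = tvalue init n.+1.
  (* Both entries lie on the fine trajectory, so the composition law of [F] links them. *)
  move=> lt_nM; rewrite !initE ?(ltnW lt_nM) // ?(ltnW (ltnW lt_nM)) //=.
  rewrite /y !add0n mulnSr -F_comp // ?leq_addr //.
  by rewrite -mulnSr leq_mul2l (ltnW lt_nM) orbT.
split=> [p|p ->]; first by rewrite /run parareal_no_iteration.
have stepsE : fine_steps (run M) = (alpha + mbar)%N.
  rewrite /run parareal_no_iteration //; congr (_ + _)%N; first by rewrite h_iii.
  exact: fine_steps_tpar.
have run_gt0 : (0 < fine_steps (run M))%N by rewrite stepsE addn_gt0 hmbar orbT.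
rewrite -stepsE; split=> [tau tau0|I Phi tau oser opar PF].
  by rewrite speedupE ?gt_eqF // !mul0r !addr0.
exact: cvg_speedup.
Qed.
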